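(* Let $\psi_1,\dots,\psi_n:\mathbb{R}^d\to\mathbb{R}$ be differentiable (not necessarily convex), $f(x)=\sum_i\psi_i(x)$, and suppose $f$ is $\mu$-strongly convex with minimizer $x^{*}$. Let $p$ be a probability distribution on $[n]$ with $p_i>0$, let $\bar S>0$ satisfy, for all $x\in\mathbb{R}^d$, $$\sum_{i\in[n]}\frac1{p_i}\|\nabla\psi_i(x)-\nabla\psi_i(x^{*})\|_2^2\le2\bar S\,[f(x)-f(x^{*})],$$ and let $0<\eta<\frac1{2\bar S}$. Starting from $x_0\in\mathbb{R}^d$, in each iteration $k$ pick $i_k\in[n]$ independently with probability $p_{i_k}$ and set $$x_{k+1}=x_k-\eta\left[\frac1{p_{i_k}}\big(\nabla\psi_{i_k}(x_k)-\nabla\psi_{i_k}(x_0)\big)+\nabla f(x_0)\right].$$ Then for all $m\ge1$, $$\mathbb{E}\left[\frac1m\sum_{k\in[m]}f(x_k)-f(x^{*})\right]\le\frac1{1-2\eta\bar S}\left[\frac1{\mu\eta m}+2\eta\bar S\right][f(x_0)-f(x^{*})].$$ Consequently, if $\eta$ is a sufficiently small constant multiple of $1/\bar S$ and $m=O(\bar S/\mu)$ (with a suitable constant), the left-hand side is at most a constant factor less than $1$ times $f(x_0)-f(x^{*})$. *)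

(* Defs.v *)
From HB Require Import structures.
From mathcomp Require Import all_boot all_order all_algebra.
From mathcomp Require Import all_classical all_reals all_analysis.

Set Implicit Arguments.
Unset Strict Implicit.
Unset Printing Implicit Defensive.

Import Order.TTheory GRing.Theory Num.Theory.
Import numFieldNormedType.Exports.

Local Open Scope classical_set_scope.
Local Open Scope ring_scope.

(* The library norm `|x| on 'rV[R]_d is the sup norm. *)
Definition norm2 (R : realType) (d : nat) (x : 'rV[R]_d) : R :=
  Num.sqrt (\sum_(j < d) x ord0 j ^+ 2).

Definition gradient (R : realType) (d : nat) (g : 'rV[R]_d -> R)
    (x : 'rV[R]_d) : 'rV[R]_d :=
  \row_(j < d) 'D_(delta_mx ord0 j) g x.

Definition strongly_convex (R : realType) (d : nat) (mu : R)
    (g : 'rV[R]_d -> R) : Prop :=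
  0 < mu /\
  forall (x y : 'rV[R]_d) (t : R), 0 <= t <= 1 ->
    g (t *: x + (1 - t) *: y) <=
    t * g x + (1 - t) * g y - mu / 2 * (t * (1 - t)) * norm2 (x - y) ^+ 2.

Definition minimizer (R : realType) (d : nat) (g : 'rV[R]_d -> R)
    (xs : 'rV[R]_d) : Prop :=
  forall x, g xs <= g x.

Section svrg.
Variables (R : realType) (n d : nat) (psi : 'I_n -> 'rV[R]_d -> R).

Definition objective (x : 'rV[R]_d) : R := \sum_(i < n) psi i x.

Record svrg_problem (mu : R) (xs : 'rV[R]_d) (p : 'I_n -> R) (S : R) : Prop :=
  SvrgProblem {
    svrg_differentiable : forall i x, differentiable (psi i) x ;
    svrg_strongly_convex : strongly_convex mu objective ;
    svrg_minimizer : minimizer objective xs ;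
    svrg_p_gt0 : forall i, 0 < p i ;
    svrg_p_sum1 : \sum_(i < n) p i = 1 ;
    svrg_S_gt0 : 0 < S ;
    svrg_variance : forall x,
      \sum_(i < n)
        (p i)^-1 * norm2 (gradient (psi i) x - gradient (psi i) xs) ^+ 2
      <= 2 * S * (objective x - objective xs)
  }.

(* [i k] is the index picked in iteration k = 0, 1, ... *)
Fixpoint svrg_iter (p : 'I_n -> R) (eta : R) (x0 : 'rV[R]_d)
    (i : nat -> 'I_n) (k : nat) : 'rV[R]_d :=
  if k is k'.+1 then
    let x := svrg_iter p eta x0 i k' in
    x - eta *: ((p (i k'))^-1 *:
                  (gradient (psi (i k')) x - gradient (psi (i k')) x0)
                + gradient objective x0)
  else x0.

(* The running average is over the iterates x_1, ..., x_m; x_0 is excluded. *)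
Definition svrg_gap (xs : 'rV[R]_d) (p : 'I_n -> R) (eta : R)
    (x0 : 'rV[R]_d) (i : nat -> 'I_n) (m : nat) : R :=
  m%:R^-1 * (\sum_(1 <= k < m.+1) objective (svrg_iter p eta x0 i k))
  - objective xs.

End svrg.

(* Random indices I_0, I_1, ... that are independent with common law p; every
   subset of 'I_n is measurable. *)
Record iid_indices (R : realType) (disp : measure_display)
    (T : measurableType disp) (P : probability T R) (n : nat)
    (p : 'I_n -> R) (I : nat -> T -> 'I_n) : Prop := IidIndices {
  iid_measurable : forall k (A : set 'I_n), measurable (I k @^-1` A) ;
  iid_law : forall k i, P (I k @^-1` [set i]) = (p i)%:E ;
  iid_independent : forall (J : seq nat) (A : nat -> set 'I_n), uniq J ->
    P (\bigcap_(k in [set` J]) (I k @^-1` A k)) =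
    (\prod_(k <- J) P (I k @^-1` A k))%E
}.

(* Main.v *)
Require Import Defs.
From HB Require Import structures.
From mathcomp Require Import all_boot all_order all_algebra.
From mathcomp Require Import all_classical all_reals all_analysis.
From mathcomp Require Import measurable_realfun ring lra.

(** Write [D x = f x - f xs] and [r x = |x - xs|^2]. Because the indices are
    independent, the expectation of a function of the first [k + 1] draws is
    obtained by averaging over the last draw first. Averaging one step gives
    [E (r x_(k+1)) <= r x_k - 2 eta (1 - 2 eta S) D x_k + 4 S eta^2 D x_0]:
    the cross term is handled by convexity, and the second moment of the step
    by the variance hypothesis at [x_k] and at [x_0]. Summing over [k < m] and
    using [r x_0 <= 2 D x_0 / mu] bounds the average over [x_0 .. x_(m-1)].
    To pass to [x_1 .. x_m] one uses [D <= 2 S r], so that the leftover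
    [E (r x_m)] absorbs [2 eta (1 - 2 eta S) E (D x_m)], since
    [4 eta S (1 - 2 eta S) <= 1]. *)

Set Implicit Arguments.
Unset Strict Implicit.
Unset Printing Implicit Defensive.

Import Order.TTheory GRing.Theory Num.Theory.
Import numFieldNormedType.Exports.

Local Open Scope classical_set_scope.
Local Open Scope ring_scope.

Lemma norm2_sqr (R : realType) (d : nat) (x : 'rV[R]_d) :
  norm2 x ^+ 2 = \sum_(j < d) x ord0 j ^+ 2.
Proof. by rewrite sqr_sqrtr// sumr_ge0// => j _; exact: sqr_ge0. Qed.

(** * Directional derivatives and minimizers *)

Section directional_derivative.
Variables (R : realType) (d : nat).
Implicit Types (f : 'rV[R]_d -> R) (x v : 'rV[R]_d).

(** The derivative is also the limit of the right difference quotients. Convexity bounds these only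
    for [t <= 1], which is enough for a limit at [0]. *)
Lemma derive_le_of_right_bound f x v (c : R) : derivable f x v ->
  (forall t, 0 < t <= 1 -> f (x + t *: v) <= f x + t * c) ->
  'D_v f x <= c.
Proof.
move=> df fc.
have cv : h^-1 *: ((f \o shift x) (h *: v) - f x) @[h --> 0^'+] --> 'D_v f x.
  exact: cvg_dnbhs_at_right.
apply: cvgr_to_le cv _; near=> t.
have t0 : 0 < t by near: t; exact: nbhs_right_gt.
have t1 : t <= 1 by near: t; exact: nbhs_right_le.
rewrite /= [X in X <= _]mulrC ler_pdivrMr// lerBlDl (mulrC c) addrC.
by rewrite [X in f X]addrC; rewrite addrC; apply: fc; rewrite t0 t1.
Unshelve. all: by end_near. Qed.

Lemma derive_gradient f x v : differentiable f x ->
  'D_v f x = \sum_(j < d) gradient f x ord0 j * v ord0 j.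
Proof.
move=> df; rewrite deriveE// {1}(row_sum_delta v) linear_sum.
apply: eq_bigr => j _; rewrite linearZ/= mxE deriveE//.
by rewrite mulrC.
Qed.

(** [derive_le_of_right_bound] for [- f] makes every directional derivative nonnegative; linearity
    in the direction, used at the opposite vector, gives the reverse sign. *)
Lemma gradient_minimizer f x : differentiable f x -> minimizer f x ->
  gradient f x = 0.
Proof.
move=> df fmin.
have D0 v : 0 <= 'D_v f x.
  have dv : derivable f x v by exact: diff_derivable.
  rewrite -oppr_le0 -deriveN//; apply: derive_le_of_right_bound.
    exact: derivableN.
  by move=> t _; rewrite mulr0 addr0 lerN2; exact: fmin.
apply/rowP => j; rewrite !mxE; apply/eqP; rewrite eq_le D0 andbT.
rewrite -oppr_ge0 deriveE// -linearN -deriveE//.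
Qed.

End directional_derivative.

(** * Consequences of strong convexity *)

Section strong_convexity.
Variables (R : realType) (d : nat) (mu : R) (f : 'rV[R]_d -> R).
Hypothesis fsc : strongly_convex mu f.

(** Strong convexity without its quadratic term bounds the slope along the segment from [x] to
    [y]. *)
Lemma strongly_convex_gradient_le x y : differentiable f x ->
  f x - f y <= \sum_(j < d) gradient f x ord0 j * (x - y) ord0 j.
Proof.
move=> df; have [mu0 fc] := fsc.
suff : 'D_(y - x) f x <= f y - f x.
  rewrite derive_gradient// => H; rewrite -lerN2 opprB (le_trans _ H)//.
  by rewrite -sumrN ler_sum// => j _; rewrite -mulrN !mxE opprB.
apply: derive_le_of_right_bound; first exact: diff_derivable.
move=> t /andP[t0 t1].
have -> : x + t *: (y - x) = t *: y + (1 - t) *: x.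
  by rewrite scalerBr scalerBl scale1r addrCA.
apply: le_trans (fc _ _ _ _) _; first by rewrite (ltW t0).
have : 0 <= mu / 2 * (t * (1 - t)) * norm2 (y - x) ^+ 2.
  by rewrite mulr_ge0 ?sqr_ge0// !mulr_ge0 ?invr_ge0 ?subr_ge0// ltW.
nra.
Qed.

Lemma strongly_convex_quadratic_growth xs x : minimizer f xs ->
  mu / 2 * norm2 (x - xs) ^+ 2 <= f x - f xs.
Proof.
move=> fmin; have [mu0 fc] := fsc.
rewrite leNgt; apply/negP; set a := mu / 2 * _; set D := f x - f xs => Da.
have D0 : 0 <= D by rewrite subr_ge0.
have a0 : 0 < a by exact: le_lt_trans D0 Da.
(* [t < 1 - D / a] contradicts the minimality of [xs] along the segment. *)
pose t := (a - D) / (2 * a).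
have t0 : 0 < t by apply: divr_gt0; [rewrite subr_gt0|exact: mulr_gt0].
have ta : t * (2 * a) = a - D by rewrite divfK// gt_eqF// mulr_gt0.
have t1 : t <= 1 by rewrite ler_pdivrMr; [nra|exact: mulr_gt0].
have := fc x xs t; rewrite (ltW t0) t1 => /(_ isT) /(le_trans (fmin _)).
have -> : mu / 2 * (t * (1 - t)) * norm2 (x - xs) ^+ 2 = t * (1 - t) * a.
  by rewrite /a; ring.
have -> : f x = D + f xs by rewrite /D subrK.
move=> H.
have : 0 <= t * (D - (1 - t) * a) by nra.
rewrite pmulr_rge0//; nra.
Qed.

End strong_convexity.

(** * Second moments under importance sampling, one coordinate at a time *)

Section importance_sampling.
Variables (R : realType) (n : nat) (p : 'I_n -> R).
Hypotheses (p_gt0 : forall i, 0 < p i) (p_sum1 : \sum_(i < n) p i = 1).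
Implicit Types g h : 'I_n -> R.

(** The variance of [g i / p i] under [p] is nonnegative, and its mean is the plain sum of [g]. *)
Lemma sqr_sum_le_weighted g :
  (\sum_(i < n) g i) ^+ 2 <= \sum_(i < n) (p i)^-1 * g i ^+ 2.
Proof.
set G := \sum_(i < n) g i.
have : 0 <= \sum_(i < n) p i * ((p i)^-1 * g i - G) ^+ 2.
  by apply: sumr_ge0 => i _; rewrite mulr_ge0 ?sqr_ge0// ltW.
rewrite (eq_bigr (fun i => (p i)^-1 * g i ^+ 2 - 2 * G * g i + G ^+ 2 * p i)).
  rewrite big_split big_split/= sumrN -!mulr_sumr p_sum1 -/G; nra.
by move=> i _; field; rewrite gt_eqF.
Qed.

(** Here [a] stands for a coordinate of [x - xs], and [g], [h] for that coordinate of the component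
    gradients at [x] and [x0], each minus its value at [xs]. The sampled direction has mean
    [\sum_i g i], whence the cross term. *)
Lemma variance_reduced_step (eta a : R) g h :
  \sum_(i < n)
    p i * (a - eta * ((p i)^-1 * (g i - h i) + \sum_(k < n) h k)) ^+ 2 <=
  a ^+ 2 - 2 * eta * ((\sum_(i < n) g i) * a)
  + 2 * eta ^+ 2 * (\sum_(i < n) (p i)^-1 * g i ^+ 2
                    + \sum_(i < n) (p i)^-1 * h i ^+ 2).
Proof.
set G := \sum_(i < n) g i; set H := \sum_(k < n) h k.
pose b i := p i * a ^+ 2 - 2 * eta * a * (g i - h i + p i * H)
  + 2 * eta ^+ 2 * ((p i)^-1 * g i ^+ 2 + (p i)^-1 * h i ^+ 2
                    - 2 * H * h i + H ^+ 2 * p i).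
(* (u - w)^2 <= 2 u^2 + 2 w^2 with u = g_i / p_i and w = h_i / p_i - H *)
have le_b i : p i * (a - eta * ((p i)^-1 * (g i - h i) + H)) ^+ 2 <= b i.
  rewrite -subr_ge0.
  have -> : b i - p i * (a - eta * ((p i)^-1 * (g i - h i) + H)) ^+ 2 =
      eta ^+ 2 * p i * ((p i)^-1 * (g i + h i) - H) ^+ 2.
    by rewrite /b; field; rewrite gt_eqF.
  by rewrite mulr_ge0 ?sqr_ge0// mulr_ge0 ?sqr_ge0// ltW.
apply: le_trans (ler_sum _ (fun i _ => le_b i)) _.
rewrite /b !big_split/= !sumrN -!mulr_sumr -mulr_suml p_sum1.
rewrite !big_split/= !sumrN -!mulr_sumr -mulr_suml p_sum1 -/G -/H.
(* The terms in [H] left in the second moment sum to [- 2 * eta ^+ 2 * H ^+ 2]: centring by the mean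
   only lowers the second moment of [h i / p i]. *)
have : 0 <= eta ^+ 2 * H ^+ 2 by rewrite mulr_ge0 ?sqr_ge0.
nra.
Qed.

End importance_sampling.

(** * Averages over finitely many independent draws *)

Section iid_mean.
Variables (R : realType) (n : nat) (p : 'I_n -> R).

(** [F] takes a sequence, so that one function serves every [k]. *)
Definition iid_mean (k : nat) (F : seq 'I_n -> R) : R :=
  \sum_(t : k.-tuple 'I_n) (\prod_(i <- t) p i) * F t.

Lemma iid_mean0 F : iid_mean 0 F = F [::].
Proof.
rewrite /iid_mean (big_pred1 [tuple]) => [|t]; first by rewrite big_nil mul1r.
by apply/esym/eqP; exact: tuple0.
Qed.

(** Independence in finite form: the weight of [rcons s i] factors, so the last draw is averaged
    first with the others fixed. *)
Lemma iid_meanS k F :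
  iid_mean k.+1 F = iid_mean k (fun s => \sum_(i < n) p i * F (rcons s i)).
Proof.
rewrite /iid_mean; under [RHS]eq_bigr do rewrite mulr_sumr.
rewrite pair_big/= (reindex (fun u : k.-tuple 'I_n * 'I_n =>
  [tuple of rcons u.1 u.2])) /=.
  by apply: eq_bigr => -[t i] _ /=; rewrite big_rcons/= mulrA.
(* The inverse of [rcons]: by [lastI], [x :: s] is [rcons (belast x s) (last x s)]. *)
exists (fun t : k.+1.-tuple 'I_n =>
  ([tuple of belast (thead t) (behead t)], last (thead t) (behead t))).
  move=> [t i] _; have /= tiE := tuple_eta [tuple of rcons t i].
  have := lastI (thead [tuple of rcons t i]) (behead (rcons t i)).
  rewrite -[LHS]/(val [tuple of thead [tuple of rcons t i] ::
    behead [tuple of rcons t i]]) -tiE/=.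
  by move=> /rcons_inj[e1 e2]; congr pair => //; apply: val_inj.
move=> t _; apply: val_inj; rewrite /= -lastI.
by rewrite [in RHS](tuple_eta t).
Qed.

Lemma iid_meanD k F G :
  iid_mean k (fun s => F s + G s) = iid_mean k F + iid_mean k G.
Proof. by rewrite -big_split; apply: eq_bigr => t _; rewrite mulrDr. Qed.

Lemma iid_meanZ k c F : iid_mean k (fun s => c * F s) = c * iid_mean k F.
Proof.
by rewrite /iid_mean mulr_sumr; apply: eq_bigr => t _; rewrite mulrCA.
Qed.

Hypotheses (p_ge0 : forall i, 0 <= p i) (p_sum1 : \sum_(i < n) p i = 1).

Lemma iid_mean_cst k c : iid_mean k (fun=> c) = c.
Proof.
elim: k => [|k IHk]; first exact: iid_mean0.
by rewrite iid_meanS; under eq_fun do rewrite -mulr_suml p_sum1 mul1r.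
Qed.

Lemma le_iid_mean k F G :
  (forall s, F s <= G s) -> iid_mean k F <= iid_mean k G.
Proof.
by move=> FG; apply: ler_sum => t _; rewrite ler_wpM2l// prodr_ge0.
Qed.

End iid_mean.

(** * From the probability space to finite averages *)

Section iid_expectation.
Variables (R : realType) (disp : measure_display) (T : measurableType disp).
Variables (P : probability T R) (n : nat) (p : 'I_n -> R).
Variable I : nat -> T -> 'I_n.
Hypothesis iid_I : iid_indices P p I.

Let draws k w := mkseq (fun j => I j w) k.

Let cylinder (t : seq 'I_n) : set T := [set w | draws (size t) w = t].

Let cylinderE (i0 : 'I_n) t : cylinder t =
  \bigcap_(j in [set` iota 0 (size t)]) (I j @^-1` [set nth i0 t j]).
Proof.
apply/seteqP; split => w /=.
  by rewrite /cylinder/= => tE j /=; rewrite mem_iota /= => jt;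
    rewrite -[in RHS]tE nth_mkseq.
move=> It; apply: (@eq_from_nth _ i0); rewrite size_mkseq// => j jt.
by rewrite nth_mkseq//; apply: It; rewrite /= mem_iota.
Qed.

Let measurable_cylinder t : measurable (cylinder t).
Proof.
(* [cylinderE] needs a default index for [nth]: a nonempty sequence supplies its head, and the empty
   one gives the whole space. *)
case: t => [|i t].
  by rewrite (_ : cylinder _ = setT)//; apply/seteqP; split.
rewrite (cylinderE i); apply: fin_bigcap_measurable; first exact: finite_seq.
by move=> j _; exact: (iid_measurable iid_I).
Qed.

Let probability_cylinder t : P (cylinder t) = (\prod_(i <- t) p i)%:E.
Proof.
case: t => [|i t].
  rewrite (_ : cylinder _ = setT) ?big_nil ?probability_setT//.
  by apply/seteqP; split.
rewrite (cylinderE i) (iid_independent iid_I) ?iota_uniq//.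
rewrite (eq_bigr (fun j => (p (nth i (i :: t) j))%:E)); last first.
  by move=> j _; exact: (iid_law iid_I).
by rewrite prodEFin [in RHS](big_nth i) /index_iota subn0.
Qed.

(** The cylinders of length [k] partition [T], so a function of the first [k] draws is a finite
    combination of indicators. *)
Let draws_sum_indic k (F : seq 'I_n -> R) w :
  F (draws k w) = \sum_(t : k.-tuple 'I_n) F t * \1_(cylinder t) w.
Proof.
have szk : size (draws k w) == k by rewrite size_mkseq.
rewrite (bigD1 (Tuple szk))//= big1 ?addr0 => [|t tw].
  by rewrite indicE mem_set ?mulr1// /cylinder/= size_mkseq.
rewrite indicE memNset ?mulr0// /cylinder/= size_tuple => tE.
by move/eqP: tw; apply; apply: val_inj.
Qed.

Let measurable_term (c : R) t :
  measurable_fun setT (fun w => (c * \1_(cylinder t) w)%:E).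
Proof.
apply/measurable_EFinP/measurable_funM; first exact: measurable_cst.
exact: measurable_indic.
Qed.

Lemma measurable_draws k (F : seq 'I_n -> R) :
  measurable_fun setT (fun w => (F (mkseq (fun j => I j w) k))%:E).
Proof.
under eq_fun do rewrite -/(draws k _) draws_sum_indic -sumEFin.
by apply: emeasurable_sum => t; exact: measurable_term.
Qed.

Lemma integral_draws k (F : seq 'I_n -> R) : (forall s, 0 <= F s) ->
  (\int[P]_w (F (mkseq (fun j => I j w) k))%:E = (iid_mean p k F)%:E)%E.
Proof.
move=> F0; under eq_integral do rewrite -/(draws k _) draws_sum_indic -sumEFin.
rewrite ge0_integral_sum//; last first.
  by move=> t w _; rewrite lee_fin mulr_ge0.
rewrite /iid_mean -sumEFin; apply: eq_bigr => t _.
under eq_integral do rewrite EFinM.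
rewrite ge0_integralZl_EFin//; last first.
  by apply/measurable_EFinP; exact: measurable_indic.
rewrite integral_indic// setIT mulrC EFinM; congr (_ * _)%E.
exact: probability_cylinder.
Qed.

End iid_expectation.

(** * The objective near its minimizer *)

Section svrg_analysis.
Variables (R : realType) (n d : nat) (psi : 'I_n -> 'rV[R]_d -> R).
Variables (mu : R) (xs : 'rV[R]_d) (p : 'I_n -> R) (S : R).
Hypothesis problem : svrg_problem psi mu xs p S.

Let f := objective psi.
Let gap x := f x - f xs.

Let mu_gt0 : 0 < mu.
Proof. by case: (svrg_strongly_convex problem). Qed.

Let S_gt0 : 0 < S. Proof. exact: svrg_S_gt0 problem. Qed.

Let p_gt0 i : 0 < p i. Proof. exact: svrg_p_gt0 problem i. Qed.

Let p_sum1 : \sum_(i < n) p i = 1. Proof. exact: svrg_p_sum1 problem. Qed.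

Let objectiveE : f = \sum_(i < n) psi i.
Proof. by apply/funext => x; rewrite fct_sumE. Qed.

Let differentiable_objective x : differentiable f x.
Proof.
rewrite objectiveE; apply: differentiable_sum => i.
exact: svrg_differentiable problem i x.
Qed.

(** The gradients at [xs] can be subtracted because they sum to the gradient of [f] at its
    minimizer, which is zero. This produces the differences of the variance hypothesis. *)
Let gradient_objective x j :
  gradient f x ord0 j =
  \sum_(i < n) (gradient (psi i) x - gradient (psi i) xs) ord0 j.
Proof.
have gE y : gradient f y ord0 j = \sum_(i < n) gradient (psi i) y ord0 j.
  rewrite mxE objectiveE derive_sum; last first.
    by move=> i; apply/diff_derivable/(svrg_differentiable problem).
  by apply: eq_bigr => i _; rewrite mxE.
rewrite (eq_bigr (fun i => gradient (psi i) x ord0 j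
  - gradient (psi i) xs ord0 j)); last by move=> i _; rewrite !mxE.
have g0 := gradient_minimizer (differentiable_objective xs)
  (svrg_minimizer problem).
by rewrite big_split/= sumrN -!gE g0 [X in _ - X]mxE subr0.
Qed.

Let gap_ge0 x : 0 <= gap x.
Proof. by rewrite subr_ge0; exact: svrg_minimizer problem x. Qed.

Let gap_le_gradient x :
  gap x <= \sum_(j < d) gradient f x ord0 j * (x - xs) ord0 j.
Proof. exact: (strongly_convex_gradient_le (svrg_strongly_convex problem)). Qed.

Let variance_coord x :
  \sum_(j < d) \sum_(i < n) (p i)^-1 *
    (gradient (psi i) x - gradient (psi i) xs) ord0 j ^+ 2 <= 2 * S * gap x.
Proof.
apply: le_trans (svrg_variance problem x).
rewrite exchange_big/=; apply: ler_sum => i _.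
by rewrite norm2_sqr mulr_sumr.
Qed.

Lemma svrg_distance_le x : norm2 (x - xs) ^+ 2 <= 2 / mu * gap x.
Proof.
have := strongly_convex_quadratic_growth (svrg_strongly_convex problem) x
  (svrg_minimizer problem).
rewrite -/f -/(gap x) => H.
by rewrite mulrAC ler_pdivlMr//; lra.
Qed.

Lemma svrg_gap_le_distance x : gap x <= 2 * S * norm2 (x - xs) ^+ 2.
Proof.
(* AM-GM: [G a <= G^2 / (4 S) + S a^2], summed over the coordinates of the
   gradient [G] and of [a = x - xs]. *)
have : 4 * S * gap x <= 2 * S * gap x + 4 * S ^+ 2 * norm2 (x - xs) ^+ 2.
  apply: le_trans (lerD (variance_coord x) (lexx _)).
  rewrite norm2_sqr mulr_sumr -big_split/=.
  have S4 : 0 <= 4 * S by rewrite mulr_ge0// ltW.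
  apply: le_trans (ler_wpM2l S4 (gap_le_gradient x)) _.
  rewrite mulr_sumr; apply: ler_sum => j _.
  apply: le_trans (lerD (sqr_sum_le_weighted p_gt0 p_sum1 _) (lexx _)).
  rewrite -gradient_objective; set G := gradient f x ord0 j.
  set a := (x - xs) ord0 j.
  by have := sqr_ge0 (G - 2 * S * a); nra.
move=> H; rewrite -(ler_pM2l (mulr_gt0 (ltr0n R 2) S_gt0)); nra.
Qed.

(** The gap is sandwiched between multiples of the squared distance at any point other than [xs];
    [0 < d] provides one. This leaves room for an integer [m] in a range proportional to
    [S / mu]. *)
Lemma svrg_mu_le : (0 < d)%N -> mu <= 4 * S.
Proof.
move=> d_gt0; pose x := xs + const_mx 1.
have r2 : norm2 (x - xs) ^+ 2 = d%:R.
  rewrite /x addrC addKr norm2_sqr; under eq_bigr do rewrite mxE expr1n.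
  by rewrite sumr_const card_ord.
have := svrg_distance_le x; have := svrg_gap_le_distance x; rewrite r2 => gd dg.
have d0 : 0 < d%:R :> R by rewrite ltr0n.
rewrite -(ler_pM2r d0); move: dg.
by rewrite mulrAC ler_pdivlMr//; nra.
Qed.

(** * One averaged step and its telescoping *)

Variables (eta : R) (x0 : 'rV[R]_d).
Hypothesis eta_gt0 : 0 < eta.

Definition svrg_step (x : 'rV[R]_d) (i : 'I_n) : 'rV[R]_d :=
  x - eta *: ((p i)^-1 *: (gradient (psi i) x - gradient (psi i) x0)
              + gradient (objective psi) x0).

Lemma svrg_iter_foldl i k :
  svrg_iter psi p eta x0 i k = foldl svrg_step x0 (mkseq i k).
Proof. by elim: k => // k IHk; rewrite mkseqS foldl_rcons -IHk. Qed.

Lemma svrg_step_le x :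
  \sum_(i < n) p i * norm2 (svrg_step x i - xs) ^+ 2 <=
  norm2 (x - xs) ^+ 2 - 2 * eta * (1 - 2 * eta * S) * gap x
  + 4 * S * eta ^+ 2 * gap x0.
Proof.
pose g i j := (gradient (psi i) x - gradient (psi i) xs) ord0 j.
pose h i j := (gradient (psi i) x0 - gradient (psi i) xs) ord0 j.
have stepE i j : (svrg_step x i - xs) ord0 j = (x - xs) ord0 j
    - eta * ((p i)^-1 * (g i j - h i j) + \sum_(k < n) h k j).
  by rewrite -gradient_objective /svrg_step /g /h !mxE -/f; ring.
(* The squared norm is a sum over coordinates, so the scalar estimate applies to each. *)
have -> : \sum_(i < n) p i * norm2 (svrg_step x i - xs) ^+ 2 =
    \sum_(j < d) \sum_(i < n) p i * ((x - xs) ord0 j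
      - eta * ((p i)^-1 * (g i j - h i j) + \sum_(k < n) h k j)) ^+ 2.
  rewrite exchange_big; apply: eq_bigr => i _; rewrite norm2_sqr mulr_sumr.
  by apply: eq_bigr => j _; rewrite stepE.
apply: le_trans (ler_sum _ (fun j _ => variance_reduced_step p_gt0 p_sum1
  eta ((x - xs) ord0 j) (g^~ j) (h^~ j))) _.
rewrite big_split/= big_split/= sumrN -!mulr_sumr big_split/= -norm2_sqr.
have -> : \sum_(j < d) (\sum_(i < n) g i j) * (x - xs) ord0 j =
    \sum_(j < d) gradient f x ord0 j * (x - xs) ord0 j.
  by apply: eq_bigr => j _; rewrite gradient_objective.
have gx := variance_coord x; have hx := variance_coord x0.
have gapx := gap_le_gradient x.
have eta2 : 0 <= 2 * eta ^+ 2 by rewrite mulr_ge0 ?sqr_ge0.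
have := ler_wpM2l eta2 (lerD gx hx).
have eta2' : 0 <= 2 * eta by rewrite mulr_ge0// ltW.
have := ler_wpM2l eta2' gapx.
rewrite /g /h; nra.
Qed.

Let x_ (s : seq 'I_n) := foldl svrg_step x0 s.
Let sqdist k := iid_mean p k (fun s => norm2 (x_ s - xs) ^+ 2).
Let mgap k := iid_mean p k (fun s => gap (x_ s)).
Let rate := 2 * eta * (1 - 2 * eta * S).

Let p_ge0 i : 0 <= p i. Proof. exact: ltW. Qed.

Lemma svrg_sqdist_step k :
  sqdist k.+1 + rate * mgap k <= sqdist k + 4 * S * eta ^+ 2 * gap x0.
Proof.
rewrite /sqdist iid_meanS -iid_meanZ -iid_meanD.
(* The additive constant becomes a mean, so that both sides are averages over the same [k] draws and
   compare pointwise. *)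
rewrite -[X in _ <= _ + X](iid_mean_cst p_sum1 k) -iid_meanD.
apply: le_iid_mean => // s.
have := svrg_step_le (x_ s); rewrite -/rate -/(x_ s).
by under eq_bigr do rewrite -foldl_rcons -/(x_ _); lra.
Qed.

Lemma svrg_sqdist_sum m :
  sqdist m + rate * (\sum_(0 <= k < m) mgap k) <=
  norm2 (x0 - xs) ^+ 2 + m%:R * (4 * S * eta ^+ 2 * gap x0).
Proof.
elim: m => [|m IHm].
  by rewrite big_geq// mulr0 mul0r /sqdist iid_mean0.
rewrite big_nat_recr//= -natr1 mulrDr mulrDl mul1r.
have := svrg_sqdist_step m; lra.
Qed.

Hypothesis eta_lt : eta < (2 * S)^-1.

Let etaS : 2 * eta * S < 1.
Proof. by rewrite mulrAC mulrC -ltr_pdivlMr ?mulr_gt0// mul1r. Qed.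

(* The telescoped bound controls the iterates 0, ..., m - 1; the last iterate
   is paid for by the squared distance left over on its left-hand side. *)
Lemma svrg_mgap_sum m :
  rate * (\sum_(1 <= k < m.+1) mgap k) <=
  (2 / mu + m%:R * (4 * S * eta ^+ 2)) * gap x0.
Proof.
have mgap_sqdist : mgap m <= 2 * S * sqdist m.
  rewrite -iid_meanZ; apply: le_iid_mean => // s.
  exact: svrg_gap_le_distance.
have sq0 : 0 <= sqdist m.
  rewrite -(iid_mean_cst p_sum1 m 0); apply: le_iid_mean => // s.
  exact: sqr_ge0.
have rate_gt0 : 0 < rate by rewrite !mulr_gt0// subr_gt0.
have last : rate * mgap m <= sqdist m.
  apply: le_trans (ler_wpM2l (ltW rate_gt0) mgap_sqdist) _.
  rewrite mulrA ler_piMl// /rate.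
  (* With [z = 4 * eta * S], [1 - rate * (2 * S)] equals [((1 - z) ^+ 2 + 1) / 2]. *)
  by have := sqr_ge0 (1 - 4 * eta * S); nra.
have mgap0 : mgap 0 = gap x0 by rewrite /mgap iid_mean0.
(* Shifting the window by one adds the last gap and removes [gap x0], whose nonnegativity lets it be
   discarded. *)
have -> : \sum_(1 <= k < m.+1) mgap k =
    \sum_(0 <= k < m) mgap k + mgap m - gap x0.
  by rewrite -big_nat_recr// big_nat_recl// mgap0 addrC addKr big_add1.
have := svrg_sqdist_sum m; have := svrg_distance_le x0.
have := mulr_ge0 (ltW rate_gt0) (gap_ge0 x0).
rewrite !(mulrBr, mulrDr) mulrDl; lra.
Qed.

(** * Expectation of the running average *)

Variables (disp : measure_display) (T : measurableType disp).
Variables (P : probability T R) (I : nat -> T -> 'I_n).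
Hypothesis iid_I : iid_indices P p I.

Lemma expectation_svrg_gap m : (0 < m)%N ->
  'E_P[fun w => svrg_gap psi xs p eta x0 (fun k => I k w) m]%E =
  (m%:R^-1 * \sum_(1 <= k < m.+1) mgap k)%:E.
Proof.
move=> m_gt0; rewrite unlock.
(* Distributing [f xs] over the [m] terms makes every integrand a nonnegative gap. *)
have gapE w : (svrg_gap psi xs p eta x0 (fun k => I k w) m)%:E =
    ((m%:R^-1)%:E * \sum_(k <- index_iota 1 m.+1)
      (gap (x_ (mkseq (fun j => I j w) k)))%:E)%E.
  rewrite sumEFin -EFinM /svrg_gap sumrB; congr EFin.
  under eq_bigr do rewrite svrg_iter_foldl -/(x_ _).
  rewrite mulrBr sumr_const_nat subSS subn0 -(mulr_natl (f xs) m) mulKf//.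
  by rewrite pnatr_eq0 -lt0n.
under eq_integral do rewrite gapE.
have mgapk k := measurable_draws iid_I k (fun s => gap (x_ s)).
rewrite ge0_integralZl_EFin//; first last.
- by apply: emeasurable_sum => k; exact: mgapk.
- by move=> w _; apply: sume_ge0 => k _; rewrite lee_fin.
rewrite ge0_integral_sum//; last by move=> k w _; rewrite lee_fin.
rewrite EFinM -sumEFin; congr (_ * _)%E; apply: eq_bigr => k _.
by rewrite (integral_draws iid_I k (F := fun s => gap (x_ s))).
Qed.

Lemma expectation_svrg_gap_le m : (0 < m)%N ->
  ('E_P[fun w => svrg_gap psi xs p eta x0 (fun k => I k w) m] <=
   ((1 - 2 * eta * S)^-1 * ((mu * eta * m%:R)^-1 + 2 * eta * S)
     * gap x0)%:E)%E.
Proof.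
move=> m_gt0; rewrite expectation_svrg_gap// lee_fin.
have m0 : 0 < m%:R :> R by rewrite ltr0n.
have th0 : 0 < 1 - 2 * eta * S by rewrite subr_gt0.
have rm : 0 < rate * m%:R by rewrite mulr_gt0// !mulr_gt0.
rewrite -(ler_pM2l rm).
have -> : rate * m%:R * (m%:R^-1 * \sum_(1 <= k < m.+1) mgap k) =
    rate * \sum_(1 <= k < m.+1) mgap k.
  by field; rewrite gt_eqF.
apply: le_trans (svrg_mgap_sum m) _.
(* Scaled by [rate * m%:R], the target is exactly the bound of [svrg_mgap_sum]. *)
rewrite le_eqVlt; apply/orP; left; apply/eqP; rewrite /rate.
by field; rewrite !gt_eqF.
Qed.

End svrg_analysis.

Theorem theorem4p1 (R : realType) :
  (forall (n d : nat) (psi : 'I_n -> 'rV[R]_d -> R) (mu : R) (xs : 'rV[R]_d)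
      (p : 'I_n -> R) (S : R) (eta : R) (x0 : 'rV[R]_d)
      (disp : measure_display) (T : measurableType disp) (P : probability T R)
      (I : nat -> T -> 'I_n),
    svrg_problem psi mu xs p S ->
    0 < eta < (2 * S)^-1 ->
    iid_indices P p I ->
    forall m : nat, (1 <= m)%N ->
      ('E_P[fun w => svrg_gap psi xs p eta x0 (fun k => I k w) m] <=
       ((1 - 2 * eta * S)^-1 * ((mu * eta * m%:R)^-1 + 2 * eta * S)
         * (objective psi x0 - objective psi xs))%:E)%E)
  /\
  (exists c0 : R, 0 < c0 /\ forall c : R, 0 < c <= c0 ->
    exists C K rho : R, [/\ 0 < C, C <= K, 0 < rho & rho < 1] /\
    forall (n d : nat) (psi : 'I_n -> 'rV[R]_d -> R) (mu : R) (xs : 'rV[R]_d)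
      (p : 'I_n -> R) (S : R) (x0 : 'rV[R]_d)
      (disp : measure_display) (T : measurableType disp) (P : probability T R)
      (I : nat -> T -> 'I_n),
    svrg_problem psi mu xs p S ->
    iid_indices P p I ->
    ((0 < d)%N -> exists m : nat, C * (S / mu) <= m%:R <= K * (S / mu)) /\
    forall m : nat, C * (S / mu) <= m%:R ->
      ('E_P[fun w => svrg_gap psi xs p (c / S) x0 (fun k => I k w) m] <=
       (rho * (objective psi x0 - objective psi xs))%:E)%E).
Proof.
split.
  move=> n d psi mu xs p S eta x0 disp T P I prb /andP[eta_gt0 eta_lt] iid_I m.
  by move=> m_gt0; exact: expectation_svrg_gap_le.
(* With [c <= 1/8], [2 * eta * S = 2 * c <= 1/4]; [C = 4 / c] forces [mu * eta * m >= 4]. The factor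
   is then at most [(1/4 + 1/4) / (1 - 1/4) = 2/3]. The extra [4] in [K] gives slack
   [4 * (S / mu) >= 1]. *)
exists (8^-1); split; first by rewrite invr_gt0.
move=> c /andP[c_gt0 c_le]; exists (4 / c), (4 / c + 4), (2 / 3).
have C_gt0 : 0 < 4 / c by rewrite divr_gt0.
split; first by split => //; lra.
move=> n d psi mu xs p S x0 disp T P I prb iid_I.
have S_gt0 := svrg_S_gt0 prb.
have mu_gt0 : 0 < mu by case: (svrg_strongly_convex prb).
have r_gt0 : 0 < 4 / c * (S / mu) by rewrite mulr_gt0 ?divr_gt0.
split=> [d_gt0|m Cm].
  have muS : 1 <= 4 * (S / mu).
    by rewrite mulrA ler_pdivlMr// mul1r (svrg_mu_le prb).
  (* Truncating and adding one exceeds the lower end by at most [1], which the slack in [K]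
     covers. *)
  have /andP[le_r r_lt] := truncn_itv (ltW r_gt0).
  exists (Num.trunc (4 / c * (S / mu))).+1; rewrite (ltW r_lt)/=.
  by rewrite -(natr1 (Num.trunc _)) (mulrDl (4 / c) 4); exact: lerD.
have m0 : 0 < m%:R :> R by exact: lt_le_trans Cm.
have eta_gt0 : 0 < c / S by rewrite divr_gt0.
have eta_lt : c / S < (2 * S)^-1.
  by rewrite invfM ltr_pM2r ?invr_gt0//; lra.
have m_gt0 : (0 < m)%N by rewrite -(ltr0n R).
apply: le_trans (expectation_svrg_gap_le prb x0 eta_gt0 eta_lt iid_I m_gt0) _.
rewrite lee_fin; apply: ler_wpM2r.
  by rewrite subr_ge0; exact: svrg_minimizer prb x0.
have -> : 2 * (c / S) * S = 2 * c by field; rewrite gt_eqF.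
have th_gt0 : 0 < 1 - 2 * c by lra.
rewrite mulrC ler_pdivrMr//.
have : (mu * (c / S) * m%:R)^-1 <= 4^-1.
  have k_gt0 : 0 < mu * (c / S) by rewrite mulr_gt0.
  rewrite lef_pV2 ?posrE//; last exact: mulr_gt0.
  apply: le_trans (ler_wpM2l (ltW k_gt0) Cm).
  by rewrite le_eqVlt; apply/orP; left; apply/eqP; field; rewrite !gt_eqF.
lra.
Qed.
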